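(* Let $\mathfrak{o}$ be the valuation ring of a non-Archimedean local field with finite residue field $\mathfrak{o}_1$, and let $q=|\mathfrak{o}_1|$. For $n\geq 1$ let $P_n\leq \mathrm{GL}_n(\mathfrak{o}_1)$ be the subgroup of all invertible $n\times n$ matrices over $\mathfrak{o}_1$ whose first row is $(1,0,\dots,0)$, i.e. \[P_n=\begin{pmatrix}1&0&\dots&0\\ *&*&\dots&*\\\vdots&\vdots&\ddots&\vdots\\ *&*&\dots&*\end{pmatrix}\cong\mathfrak{o}_1^{n-1}\rtimes \mathrm{GL}_{n-1}(\mathfrak{o}_1).\] Then the representation zeta polynomial of $P_n$ is given inductively by $\mathcal{R}_{P_1}(\mathcal{D})=\mathcal{D}$ and, for $n\geq 2$, \[\mathcal{R}_{P_n}(\mathcal{D})=\mathcal{R}_{P_{n-1}}(\mathcal{D}^{q^{n-1}-1})+\mathcal{R}_{\mathrm{GL}_{n-1}(\mathfrak{o}_1)}(\mathcal{D}).\]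
   Context: For a finite group $G$, $\mathrm{Irr}(G)$ denotes the set of irreducible complex representations of $G$ up to isomorphism. The representation zeta polynomial of $G$ is \[\mathcal{R}_G(\mathcal{D})=\sum_{\rho\in\mathrm{Irr}(G)}\mathcal{D}^{\dim\rho}\in\mathbb{Z}[\mathcal{D}],\] where $\mathcal{D}$ is an indeterminate; $\mathcal{R}_G(\mathcal{D}^k)$ denotes the polynomial obtained by substituting $\mathcal{D}^k$ for $\mathcal{D}$. In the semidirect product, $\mathrm{GL}_{n-1}(\mathfrak{o}_1)$ acts on column vectors $\mathfrak{o}_1^{n-1}$ by left multiplication; $P_1$ is the trivial group (and $\mathrm{GL}_0(\mathfrak{o}_1)$ is trivial). *)

(* Defs.v *)
From HB Require Import structures.
From mathcomp Require Import all_boot all_order all_algebra all_fingroup.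
From mathcomp Require Import all_solvable all_field all_character.

Set Implicit Arguments.
Unset Strict Implicit.
Unset Printing Implicit Defensive.

Import Order.TTheory GRing.Theory Num.Theory GroupScope.
Local Open Scope ring_scope.

(* A valuation is a map v : K -> int whose value at 0 carries no meaning
   (mathematically v 0 = +oo); [val_ge v N x] is "N <= v x" with this
   convention. *)
Definition val_ge (K : fieldType) (v : K -> int) (N : int) (x : K) : bool :=
  (x == 0) || (N <= v x).

(* A non-Archimedean local field: K is complete for a normalized discrete
   valuation v.  Finiteness of the residue field is enforced by the type of o1
   in [is_residue_field] below. *)
Record nonarchimedean_local_field (K : fieldType) (v : K -> int) : Prop := {
  valM : forall x y : K, x != 0 -> y != 0 -> v (x * y) = v x + v y;
  valD : forall (N : int) (x y : K),
    val_ge v N x -> val_ge v N y -> val_ge v N (x + y);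
  val_uniformizer : exists2 x : K, x != 0 & v x = 1;
  val_complete : forall u : nat -> K,
    (forall N : int, exists M : nat, forall m n : nat,
        (M <= m)%N -> (M <= n)%N -> val_ge v N (u m - u n)) ->
    exists l : K, forall N : int, exists M : nat, forall n : nat,
        (M <= n)%N -> val_ge v N (u n - l)
}.

Definition is_valuation_ring (K : fieldType) (v : K -> int)
    (o : comNzRingType) (iota : {rmorphism o -> K}) : Prop :=
  injective iota /\
  forall x : K, (exists a : o, iota a = x) <-> val_ge v 0 x.

(* red identifies o1 with the quotient of o by its maximal ideal. *)
Definition is_residue_field (K : fieldType) (v : K -> int)
    (o : comNzRingType) (iota : {rmorphism o -> K})
    (o1 : finFieldType) (red : {rmorphism o -> o1}) : Prop :=
  (forall y : o1, exists a : o, red a = y) /\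
  forall a : o, red a = 0 <-> val_ge v 1 (iota a).

(* Complex representations are taken over algC, the library's complex
   algebraic numbers.  'Chi_i, for i : Iirr G, runs through representatives of
   the isomorphism classes of irreducible representations of G, and acts on
   row vectors of length irr_degree (socle_of_Iirr i). *)
Definition rep_zeta (gT : finGroupType) (G : {group gT}) : {poly int} :=
  \sum_(i : Iirr G) 'X^(irr_degree (socle_of_Iirr i)).

(* {'GL_n[F]} consists of invertible matrices of size n.-1.+1, which is n for
   n >= 1 (only such n are relevant); ord0 is the first row/column index. *)
Definition P_set (F : finFieldType) (n : nat) : {set {'GL_n[F]}} :=
  [set g : {'GL_n[F]} | [forall j, GLval g ord0 j == (j == ord0)%:R]].

Lemma P_setE (F : finFieldType) (n : nat) (g : {'GL_n[F]}) :
  (g \in P_set F n) = (row ord0 (GLval g) == delta_mx ord0 ord0).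
Proof.
rewrite inE; apply/forallP/eqP => [h | /rowP h j].
  by apply/rowP => j; rewrite !mxE (eqP (h j)).
by have := h j; rewrite !mxE eqxx /= => ->.
Qed.

Lemma P_group_set (F : finFieldType) (n : nat) : group_set (P_set F n).
Proof.
apply/group_setP; split=> [|x y]; rewrite !P_setE.
  by rewrite GL_1E row1.
by rewrite GL_MxE row_mul => /eqP-> hy; rewrite -rowE.
Qed.

Canonical P (F : finFieldType) (n : nat) : {group {'GL_n[F]}} :=
  Group (P_group_set F n).

(* Main.v *)
(* Let N be the kernel of the projection P_n -> GL_{n-1}, an abelian group
   isomorphic to o1^{n-1}.  The irreducible characters of P_n trivial on N are
   those of GL_{n-1}.  Fix a nontrivial character chi of (o1, +) and let lambda
   be the character c |-> chi (c_0) of N.  Its inertia group T consists of the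
   g whose linear part has first row (1, 0, ..., 0), so T / N is P_{n-1} and T
   has index q^{n-1} - 1, the number of nontrivial characters of N.  Hence these
   are all conjugate to lambda; as lambda extends to a linear character of T,
   the Clifford correspondence and Gallagher's theorem identify the remaining
   irreducible characters of P_n with those of P_{n-1}, with degrees multiplied
   by q^{n-1} - 1. *)

Require Import Defs.
From HB Require Import structures.
From mathcomp Require Import all_boot all_order all_algebra all_fingroup.
From mathcomp Require Import all_solvable all_field all_character.

Set Implicit Arguments.
Unset Strict Implicit.
Unset Printing Implicit Defensive.

Import Order.TTheory GRing.Theory Num.Theory GroupScope.
Local Open Scope ring_scope.

(** * Degrees and invariance of the zeta polynomial under isomorphism *)

(** Exponents in [rep_zeta] are natural numbers, while character theory yields identities between
    values at 1 in [algC]; this transfers the latter to the former. *)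
Lemma irr_degree_eq (gT hT : finGroupType) (G : {group gT}) (H : {group hT})
    (i : Iirr G) (j : Iirr H) (m : nat) :
  'chi_i 1%g = m%:R * 'chi_j 1%g ->
  irr_degree (socle_of_Iirr i) = (m * irr_degree (socle_of_Iirr j))%N.
Proof. by rewrite !irr1_degree -natrM => /eqP; rewrite eqr_nat => /eqP. Qed.

Lemma rep_zeta_isog (gT hT : finGroupType) (G : {group gT}) (H : {group hT}) :
  G \isog H -> rep_zeta G = rep_zeta H.
Proof.
case/isogP=> f injf fG; have isoGH : isom G H f by apply/isomP.
rewrite /rep_zeta [RHS](reindex (isom_Iirr isoGH)) /=; last first.
  by exists (isom_Iirr (isom_sym isoGH)) => i _;
    rewrite ?isom_IirrK ?isom_IirrKV.
apply: eq_bigr => i _; congr ('X^_); rewrite -[RHS]mul1n.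
by apply: irr_degree_eq; rewrite mul1r isom_IirrE cfIsom1.
Qed.

Lemma rep_zeta_trivial (gT : finGroupType) (G : {group gT}) :
  G :=: 1%g -> rep_zeta G = 'X.
Proof.
move=> G1; have cG: abelian G by rewrite G1 abelian1.
have cardG: #|Iirr G| = 1%N by rewrite card_Iirr_abelian // G1 cards1.
rewrite /rep_zeta (eq_bigr (fun=> 'X)) ?sumr_const ?cardG ?mulr1n // => i _.
rewrite -[RHS]expr1; congr ('X^_); apply/eqP.
by rewrite -(eqr_nat algC) -irr1_degree lin_char1 //; apply/char_abelianP.
Qed.

(** * Clifford theory over an abelian normal subgroup *)

Section AbelianNormal.

Variables (gT : finGroupType) (G N : {group gT}) (t : Iirr N).
Hypotheses (nsNG : N <| G) (cNN : abelian N) (t_neq0 : t != 0).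
Local Notation T := ('I_G['chi_t])%G.
Hypothesis oGT : #|G : T| = #|N|.-1.

(** A counting argument: the orbit of [t] consists of nontrivial characters and has [#|G : T|] =
    [#|N|.-1] members, which is the number of all nontrivial characters of the abelian group [N]. *)
Lemma nontrivial_irr_cfclass (j : Iirr N) :
  j != 0 -> 'chi_j \in ('chi_t ^: G)%CF.
Proof.
move=> j_neq0; rewrite -cfclass_IirrE.
suff ->: cfclass_Iirr G t = [set~ 0] by rewrite !inE.
apply/eqP; rewrite eqEcard; apply/andP; split.
  by apply/subsetP=> _ /imsetP[y _ ->]; rewrite !inE conjg_Iirr_eq0.
by rewrite card_cfclass_Iirr // oGT cardsC1 card_Iirr_abelian.
Qed.

(** By Frobenius reciprocity the left side says that [t] occurs in the restriction to [N]. If [N] is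
    not in the kernel, some nontrivial character occurs there; it is conjugate to [t], and
    conjugates occur with equal multiplicity. *)
Lemma constt_Ind_nontrivial (i : Iirr G) :
  (i \in irr_constt ('Ind[G] 'chi_t)) = ~~ (N \subset cfker 'chi_i).
Proof.
rewrite constt_Ind_Res; apply/idP/idP=> [iNt | not_ker].
  apply/negP=> /cfRes_sub_ker resE.
  move: iNt; rewrite resE irr_consttE cfdotZl -irr0 cfdot_irr (eq_sym 0).
  by rewrite (negbTE t_neq0) mulr0 eqxx.
have /neq0_has_constt[j iNj]: 'Res[N] 'chi_i != 0 by apply: Res_irr_neq0.
have j_neq0: j != 0.
  by apply: contraNneq not_ker => j0; rewrite constt0_Res_cfker // -j0.
have /cfclassP[y Gy def_j] := nontrivial_irr_cfclass j_neq0.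
by move: iNj; rewrite !irr_consttE def_j cfdot_Res_conjg.
Qed.

(** [S] is a second name for the inertia group, so that an extension [c] built on a group described
    differently, such as a preimage, can be supplied directly. *)
Lemma rep_zeta_abelian_normal (S : {group gT}) (c : Iirr S) :
  S :=: T -> 'Res[N] 'chi_c = 'chi_t ->
  rep_zeta G =
    (rep_zeta (S / N)%G \Po 'X^(#|N|.-1)) + rep_zeta (G / N)%G.
Proof.
move/group_inj=> defS; rewrite {S}defS in c * => resc.
have sNT: N \subset T by apply: sub_Inertia; apply: normal_sub.
have nsNT : N <| T by apply: normal_Inertia; apply: normal_sub.
have sTG : T \subset G := Inertia_sub G 'chi_t.
rewrite /rep_zeta (bigID (fun i : Iirr G => N \subset cfker 'chi_i)) addrC /=.
congr (_ + _).
  rewrite (reindex _ (mod_Iirr_bij nsNG)) /=; apply: eq_big => i.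
    by rewrite mod_IirrE ?cfker_mod.
  move=> _; congr ('X^_); rewrite -[RHS]mul1n; apply: irr_degree_eq.
  by rewrite mul1r mod_IirrE // cfMod1.
have [ind_irr ind_inj ind_im _ _] := constt_Inertia_bijection t nsNG.
have [ext_irr ext_inj ext_im _] := constt_Ind_ext nsNT resc.
transitivity (\sum_(i in Ind_Iirr G @: irr_constt ('Ind[T] 'chi_t))
   'X^(irr_degree (socle_of_Iirr i)) : {poly int}).
  by apply: eq_bigl => i; rewrite ind_im constt_Ind_nontrivial.
rewrite big_imset //=.
transitivity (\sum_(s in [set mul_mod_Iirr c b | b in Iirr (T / N)])
   'X^(irr_degree (socle_of_Iirr (Ind_Iirr G s))) : {poly int}).
  apply: eq_bigl => s; rewrite ext_im; apply/codomP/imsetP.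
    by case=> b ->; exists b.
  by case=> b _ ->; exists b.
rewrite big_imset /=; last by move=> b1 b2 _ _; apply: ext_inj.
rewrite raddf_sum; apply: eq_bigr => b _ /=.
rewrite comp_Xn_poly -exprM; congr ('X^_); apply: irr_degree_eq.
rewrite cfIirrE; last first.
  by apply: ind_irr; rewrite ext_im codom_f.
(* Induction multiplies the degree by [#|N|.-1]; the factor [c] contributes 1, because its
   restriction [t] to the abelian group [N] is linear. *)
rewrite cfInd1 // oGT /mul_mod_Iirr /mul_Iirr cfIirrE ?ext_irr //.
rewrite cfunE mod_IirrE // cfMod1 -(cfResE _ sNT) ?group1 // resc.
by rewrite lin_char1 ?mulr1 //; apply/char_abelianP.
Qed.

End AbelianNormal.

Lemma GLval_unitmx (F : finFieldType) (n : nat) (g : {'GL_n[F]}) :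
  GLval g \in unitmx.
Proof. exact: GL_unit g. Qed.

(** * Affine coordinates on P_n, with n = k + 2 *)

Section AffineGroup.

Variables (F : finFieldType) (k : nat).

(** The default 1 of [insubd] is never taken, since the block matrix has the determinant of [A]. The
    size is written [1 + k.+1] to make block operations available. *)
Definition affine_GL (c : 'cV[F]_k.+1) (A : {'GL_k.+1[F]}) : {'GL_k.+2[F]} :=
  insubd (1%g : {'GL_k.+2[F]}) (block_mx 1 0 c (GLval A) : 'M[F]_(1 + k.+1)).

(** The default 1 can occur only for [g] outside [P], where the lower right block may be
    singular. *)
Definition linear_part (g : {'GL_k.+2[F]}) : {'GL_k.+1[F]} :=
  insubd (1%g : {'GL_k.+1[F]}) (drsubmx (GLval g : 'M[F]_(1 + k.+1))).

Definition translation_part (g : {'GL_k.+2[F]}) : 'cV[F]_k.+1 :=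
  dlsubmx (GLval g : 'M[F]_(1 + k.+1)).

Lemma affine_GLE (c : 'cV[F]_k.+1) (A : {'GL_k.+1[F]}) :
  GLval (affine_GL c A) = block_mx 1 0 c (GLval A) :> 'M[F]_(1 + k.+1).
Proof.
have uB : block_mx 1 0 c (GLval A) \in unitmx.
  by rewrite unitmxE det_lblock det1 mul1r -unitmxE; apply: (GLval_unitmx A).
exact: (@insubdK _ _ {'GL_k.+2[F]} 1%g _ uB).
Qed.

Lemma translation_partK (c : 'cV[F]_k.+1) (A : {'GL_k.+1[F]}) :
  translation_part (affine_GL c A) = c.
Proof. by rewrite /translation_part affine_GLE block_mxKdl. Qed.

Lemma linear_partK (c : 'cV[F]_k.+1) (A : {'GL_k.+1[F]}) :
  linear_part (affine_GL c A) = A.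
Proof. by rewrite /linear_part affine_GLE block_mxKdr; apply: valKd. Qed.

Lemma affine_GL_P (c : 'cV[F]_k.+1) (A : {'GL_k.+1[F]}) :
  affine_GL c A \in P F k.+2.
Proof.
have row0 (j : 'I_(1 + k.+1)) :
    block_mx 1 0 c (GLval A) ord0 j = (j == ord0)%:R.
  have ->: ord0 = lshift k.+1 ord0 :> 'I_(1 + k.+1) by apply: val_inj.
  case: (split_ordP j) => i ->; first by rewrite block_mxEul !ord1 mxE !eqxx.
  by rewrite block_mxEur mxE eq_rlshift.
rewrite inE; apply/forallP=> j; rewrite affine_GLE.
by apply/eqP/row0.
Qed.

Lemma affine_GL_surj (g : {'GL_k.+2[F]}) :
  g \in P F k.+2 -> g = affine_GL (translation_part g) (linear_part g).
Proof.
rewrite inE => /forallP g0; pose M : 'M[F]_(1 + k.+1) := GLval g.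
have lift0E: lshift k.+1 ord0 = ord0 :> 'I_(1 + k.+1) by apply: val_inj.
have ulM: ulsubmx M = 1.
  apply/matrixP=> i j; rewrite !ord1 !mxE lift0E.
  by rewrite (eqP (g0 ord0)).
have urM: ursubmx M = 0.
  apply/matrixP=> i j; rewrite ord1 !mxE lift0E.
  by rewrite (eqP (g0 (rshift 1 j : 'I_(1 + k.+1)))).
have defM: M = block_mx 1 0 (dlsubmx M) (drsubmx M).
  by rewrite -[LHS]submxK ulM urM.
have uM: drsubmx M \is a GRing.unit.
  have: M \in unitmx by apply: (GLval_unitmx g).
  by rewrite defM unitmxE det_lblock det1 mul1r -unitmxE block_mxKdr.
have lE: GLval (linear_part g) = drsubmx M := insubdK (1%g : {'GL_k.+1[F]}) uM.
by apply: val_inj; apply: etrans defM _; rewrite -lE; apply/esym/affine_GLE.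
Qed.

Lemma affine_GLM (c d : 'cV[F]_k.+1) (A B : {'GL_k.+1[F]}) :
  (affine_GL c A * affine_GL d B)%g = affine_GL (c + GLval A *m d) (A * B)%g.
Proof.
apply: val_inj; apply: etrans (esym (affine_GLE _ _)).
change ((GLval (affine_GL c A) : 'M_(1 + k.+1)) *m GLval (affine_GL d B)
  = block_mx 1 0 (c + GLval A *m d) (GLval A *m GLval B)).
rewrite !affine_GLE (mulmx_block 1 0 c _ 1 0 d).
by rewrite !mulmx1 !mul1mx !mul0mx !mulmx0 !addr0 add0r.
Qed.

(** * The projection to the linear part, its kernel and the index of the stabilizer *)

Lemma linear_partM :
  {in P F k.+2 &, {morph linear_part : x y / (x * y)%g}}.
Proof.
move=> x y /affine_GL_surj-> /affine_GL_surj->.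
by rewrite affine_GLM !linear_partK.
Qed.
Canonical linear_part_morphism := Morphism linear_partM.

Local Notation G := (P F k.+2).
Local Notation f := linear_part_morphism.
Local Notation N := ('ker f)%G.
Local Notation T := (f @*^-1 P F k.+1)%G.

Lemma affine_GL_ker (c : 'cV[F]_k.+1) : affine_GL c 1 \in N.
Proof. by apply/kerP; [apply: affine_GL_P | rewrite /= linear_partK]. Qed.

Lemma ker_linear_part : 'ker f = [set affine_GL c 1 | c in 'cV[F]_k.+1].
Proof.
apply/setP=> g; apply/idP/imsetP=> [kg | [c _ ->]].
  have Gg: g \in G := dom_ker kg.
  exists (translation_part g) => //; rewrite {1}(affine_GL_surj Gg).
  by congr affine_GL; apply: (mker kg).
exact: affine_GL_ker.
Qed.

Lemma card_ker_linear_part : #|'ker f| = (#|F| ^ k.+1)%N.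
Proof.
rewrite ker_linear_part card_imset ?card_mx ?muln1 //.
exact: can_inj (fun c => translation_partK c 1).
Qed.

Lemma ker_linear_part_abelian : abelian ('ker f).
Proof.
apply/centsP; rewrite ker_linear_part => x /imsetP[c _ ->] y /imsetP[d _ ->].
by rewrite /commute !affine_GLM !mul1mx addrC.
Qed.

Lemma linear_part_im : f @* G = 'GL_k.+1[F].
Proof.
apply/eqP; rewrite eqEsubset subsetT; apply/subsetP=> A _.
by rewrite -(linear_partK 0 A); apply: mem_morphim; apply: affine_GL_P.
Qed.

(** [P] is the stabilizer of the first basis row under right multiplication, so its right cosets are
    the fibres of the first-row map [r], whose image is the set of nonzero rows. *)
Lemma index_P : #|'GL_k.+1[F] : P F k.+1| = (#|F| ^ k.+1).-1.
Proof.
pose r (g : {'GL_k.+1[F]}) : 'rV[F]_k.+1 := row ord0 (GLval g).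
have rM x y : r (x * y)%g = r x *m GLval y by rewrite /r GL_MxE row_mul.
have r_surj (v : 'rV[F]_k.+1) : v != 0 -> exists g, r g = v.
  move=> nz_v; pose e : 'rV[F]_k.+1 := delta_mx 0 ord0.
  (* Every row of [V] is [v], so [e *m V] = [v] has rank 1 like [e]; [complete_unitmx] then replaces
     [V] by an invertible matrix with the same effect on [e]. *)
  pose V : 'M[F]_k.+1 := \matrix_i v.
  have eV : e *m V = v by rewrite -rowE rowK.
  have [|h uh eh] := @complete_unitmx _ _ _ e V.
    have nz_e : e != 0.
      by apply/eqP=> /rowP/(_ ord0)/eqP; rewrite !mxE !eqxx oner_eq0.
    by rewrite eV !rank_rV nz_v nz_e.
  exists (insubd (1%g : {'GL_k.+1[F]}) h).
  rewrite /r [GLval _](@insubdK _ _ {'GL_k.+1[F]}) // rowE.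
  by rewrite -[LHS]eh eV.
pose fib (v : 'rV[F]_k.+1) : {set {'GL_k.+1[F]}} := [set g | r g == v].
have fibE x : P F k.+1 :* x = fib (r x).
  apply/setP=> y; rewrite mem_rcoset P_setE inE -/(r _) rM.
  by rewrite -(can_eq (mulmxK (GLval_unitmx x))) mulmxKV ?GLval_unitmx // -rowE.
have -> : (#|F| ^ k.+1).-1 = #|[set~ (0 : 'rV[F]_k.+1)]|.
  by rewrite cardsC1 card_mx mul1n.
rewrite -(card_in_imset (f := fib)); last first.
  move=> u v; rewrite !inE => /r_surj[x <-] _ /setP/(_ x).
  by rewrite !inE eqxx => /esym/eqP.
apply: eq_card => C; apply/rcosetsP/imsetP=> [[x _ ->] | [v]].
  exists (r x); rewrite ?fibE // !inE.
  (* A zero first row of [x] would, after multiplication by the inverse of [x], make the first row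
     of the identity zero. *)
  apply: contraTneq (GLval_unitmx x) => rx0.
  apply/negP=> ux; have := mulmxK ux (r 1%g).
  rewrite -rM mul1g rx0 mul0mx /r GL_1E row1 => /matrixP/(_ 0 ord0)/eqP.
  by rewrite !mxE !eqxx eq_sym oner_eq0.
by rewrite !inE => /r_surj[x <-] ->; exists x; rewrite ?fibE ?inE.
Qed.

Lemma index_linear_stabilizer : #|G : T| = #|'ker f|.-1.
Proof.
have sGLf: 'GL_k.+1[F] \subset f @* G by rewrite linear_part_im.
by rewrite card_ker_linear_part -index_P -(index_morphpre _ sGLf) morphpreT.
Qed.

(** * Linear characters of the stabilizer *)

Lemma P_mul_col0 (A : {'GL_k.+1[F]}) (d : 'cV[F]_k.+1) :
  A \in P F k.+1 -> (GLval A *m d) ord0 ord0 = d ord0 ord0.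
Proof.
rewrite P_setE => /eqP rA.
have ->: (GLval A *m d) ord0 ord0 = row ord0 (GLval A *m d) ord0 ord0.
  by rewrite [RHS]mxE.
by rewrite row_mul rA -rowE mxE.
Qed.

(* On the stabilizer T of the first row the top entry of the translation part
   is additive, so characters of (F, +) pull back to linear characters of T. *)
Definition first_translation (g : {'GL_k.+2[F]}) : F :=
  translation_part g ord0 ord0.

Lemma first_translationM :
  {in T &, {morph first_translation : x y / (x * y)%g}}.
Proof.
move=> x y /morphpreP[Gx Px] /morphpreP[Gy _]; rewrite /first_translation.
rewrite {1}(affine_GL_surj Gx) {1}(affine_GL_surj Gy) affine_GLM.
by rewrite !translation_partK mxE P_mul_col0.
Qed.
Canonical first_translation_morphism := Morphism first_translationM.
Local Notation s := first_translation_morphism.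

Lemma ker_sub_stabilizer : 'ker f \subset T.
Proof. by rewrite morphpreS // sub1set group1. Qed.

Lemma first_translation_im : s @* T = [set: F].
Proof.
apply/eqP; rewrite eqEsubset subsetT; apply/subsetP=> a _.
have Ta : affine_GL (const_mx a) 1 \in T.
  by apply/morphpreP; rewrite affine_GL_P /= linear_partK.
apply/morphimP; exists (affine_GL (const_mx a) 1) => //=.
by rewrite /first_translation translation_partK mxE.
Qed.

(** * The recursion step *)

Lemma rep_zeta_P :
  rep_zeta G =
    (rep_zeta (P F k.+1) \Po 'X^(#|F| ^ k.+1 - 1)%N) + rep_zeta 'GL_k.+1[F]%G.
Proof.
have sTG : T \subset G := subsetIl _ _.
have sNT := ker_sub_stabilizer.
have nsNG : N <| G := ker_normal f.
(* The additive character is taken on [s @* T], which is all of [F], so that it can be pulled back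
   along [s]. *)
have [k0 nz_k0] : {k0 : Iirr (s @* T) | k0 != 0}.
  apply: has_nonprincipal_irr; rewrite [X in X :!=: _]first_translation_im.
  apply/trivgPn; exists (1 : F); rewrite ?inE //.
  exact: oner_neq0.
have lin_k0 : 'chi_k0 \is a linear_char.
  by apply/char_abelianP/centsP=> x _ y _; apply: addrC.
pose chi := 'chi_k0.
have memF a : a \in s @* T by move: (in_setT a); rewrite -first_translation_im.
have chiD a b : chi (a + b) = chi a * chi b by apply: (lin_charM lin_k0).
have [a chi_a] : exists a, chi a != 1.
  apply/existsP; apply: contraR nz_k0; rewrite negb_exists => /forallP triv.
  rewrite -irr_eq1; apply/eqP/cfun_inP=> x Fx; rewrite cfun1E Fx.
  exact/eqP/negPn/triv.
(* [c] is the pullback to [T], and its restriction [t] is the character lambda of [N]; thus [t]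
   extends to [T] by construction. *)
pose c := morph_Iirr k0; pose t := Res_Iirr N c.
have lin_c : 'chi_c \is a linear_char.
  by rewrite morph_IirrE // cfMorph_lin_char.
have resc : 'Res[N] 'chi_c = 'chi_t.
  by apply/esym/cfIirrE/lin_char_irr/cfRes_lin_char.
have chi_tE d : 'chi_t (affine_GL d 1) = chi (d ord0 ord0).
  have Nd : affine_GL d 1 \in N := affine_GL_ker d.
  rewrite -resc cfResE // morph_IirrE // cfMorphE // ?(subsetP sNT) //=.
  by rewrite /first_translation translation_partK.
have nz_t : t != 0.
  apply: contraNneq chi_a => t0; have := chi_tE (const_mx a).
  rewrite t0 irr0 cfun1E mxE affine_GL_ker => <-.
  exact: eqxx.
have defT : T :=: 'I_G['chi_t].
  have nsNT : N <| T := normalS sNT sTG nsNG.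
  apply/eqP; rewrite eqEsubset subsetI sTG (extendible_irr_invariant nsNT resc).
  (* Conjugating the translation by [d] with the inverse of [g] gives the translation by
     [GLval A *m d], so invariance of [t] becomes the identity [chiA]. *)
  apply/subsetP=> g /setIP[Gg It_g]; apply/morphpreP; split=> //=.
  set A := linear_part g; pose b := translation_part g.
  have defg : g = affine_GL b A := affine_GL_surj Gg.
  have chiA (d : 'cV[F]_k.+1) :
      chi ((GLval A *m d) ord0 ord0) = chi (d ord0 ord0).
    rewrite -[LHS](chi_tE (GLval A *m d)) -[RHS]chi_tE.
    rewrite -(inertia_valJ (affine_GL d 1) (groupVr It_g)).
    congr ('chi_t _); rewrite conjgE invgK mulgA; apply: (canRL (mulgK _)).
    by rewrite defg !affine_GLM mulg1 mul1g mul1mx addrC.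
  rewrite inE; apply/forallP=> j; apply: contraR chi_a => nz_r.
  set r := GLval A ord0 j - (j == ord0)%:R.
  have {}nz_r : r != 0 by rewrite subr_eq0.
  (* If the first row of [A] differs from the basis row by [r] at column [j], this column [d] is
     chosen so that [A] adds exactly [a] to its top entry; [chiA] then forces [chi a] = 1. *)
  have := chiA ((a / r) *: delta_mx j ord0).
  rewrite -scalemxAr -colE !mxE.
  have -> : a / r * GLval A ord0 j = a + a / r * (ord0 == j)%:R.
    rewrite -[X in X + _](divfK nz_r) -mulrDr; congr (_ * _).
    by rewrite /r eq_sym subrK.
  rewrite andbT chiD -[RHS]mul1r => /mulIf-> //.
  exact: lin_char_neq0.
have oGT : #|G : 'I_G['chi_t]| = #|'ker f|.-1.
  by rewrite -defT index_linear_stabilizer.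
have cNN := ker_linear_part_abelian.
rewrite (rep_zeta_abelian_normal nsNG cNN nz_t oGT defT resc).
rewrite card_ker_linear_part subn1; congr (_ \Po _ + _).
  apply: rep_zeta_isog.
  (* The isomorphism of [G / N] with the image of [f] carries [T / N] to [f @* T], the smaller group
     [P]. *)
  have [g injg gE] := first_isom f.
  have fT : f @* T = P F k.+1 by rewrite morphpreK ?linear_part_im ?subsetT.
  by rewrite -fT -gE // sub_isog // quotientS.
apply: rep_zeta_isog.
have := first_isog f.
by rewrite linear_part_im.
Qed.
End AffineGroup.

(** * The base case and the full induction formula *)

Lemma P1_trivial (F : finFieldType) : P F 1 :=: 1%g.
Proof.
apply/trivgP/subsetP=> g; rewrite P_setE !inE => /eqP row_g.
apply/eqP/val_inj/matrixP=> i j; rewrite !ord1 /=.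
by have /rowP/(_ ord0) := row_g; rewrite !mxE !eqxx.
Qed.

Theorem proposition3
    (K : fieldType) (v : K -> int)
    (o : comNzRingType) (iota : {rmorphism o -> K})
    (o1 : finFieldType) (red : {rmorphism o -> o1})
    (hK : nonarchimedean_local_field v)
    (ho : is_valuation_ring v iota)
    (ho1 : is_residue_field v iota red) :
  rep_zeta (P o1 1) = 'X /\
  forall n : nat, (2 <= n)%N ->
    rep_zeta (P o1 n) =
      (rep_zeta (P o1 n.-1) \Po 'X^(#|o1| ^ n.-1 - 1)%N)
      + rep_zeta 'GL_n.-1[o1]%G.
Proof.
split; first by apply/rep_zeta_trivial/P1_trivial.
by case=> [|[|k]] // _; apply: rep_zeta_P.
Qed.
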